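(* Let $\kappa$ be a regular uncountable cardinal. If $\chi\in\mathrm{spec}(\kappa)$, then there exists a closed witness to $\mathrm{U}(\kappa,\kappa,\chi,\chi)$.
   Context: A $C$-sequence over $\kappa$ is $\vec C=\langle C_\beta\mid\beta<\kappa\rangle$ with each $C_\beta$ closed in $\beta$ and $\sup(C_\beta)=\sup(\beta)$. $\chi(\vec C)$ is the least cardinal $\chi\le\kappa$ such that there exist $\Delta\in[\kappa]^\kappa$ and $b:\kappa\to[\kappa]^\chi$ with $\Delta\cap\alpha\subseteq\bigcup_{\beta\in b(\alpha)}C_\beta$ for every $\alpha<\kappa$; $\mathrm{spec}(\kappa)=\{\chi(\vec C)\mid\vec C\text{ a }C\text{-sequence over }\kappa\}\setminus\omega$. For sets of ordinals, $a<b$ means every element of $a$ is below every element of $b$; $(a,b)\in[\mathcal B]^2$ means $a,b\in\mathcal B$ and $a<b$; $c(\alpha,\beta)=c(\{\alpha,\beta\})$, $c[a\times b]=\{c(\alpha,\beta)\mid\alpha\in a,\beta\in b\}$. $\mathrm{U}(\kappa,\mu,\theta,\chi)$ asserts the existence of $c:[\kappa]^2\to\theta$ (a witness) such that for every cardinal $\chi'<\chi$, every family $\mathcal A\subseteq[\kappa]^{\chi'}$ of $\kappa$-many pairwise disjoint sets, and every $i<\theta$, there is $\mathcal B\in[\mathcal A]^\mu$ with $\min(c[a\times b])>i$ for all $(a,b)\in[\mathcal B]^2$. With $\mathrm{acc}^+(a)=\{\alpha<\sup\{\gamma+1\mid\gamma\in a\}\mid\sup(a\cap\alpha)=\alpha>0\}$,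 a coloring $c:[\kappa]^2\to\theta$ is closed if for all $\beta<\kappa$ and $i\le\theta$, $D^c_{\le i}(\beta)=\{\alpha<\beta\mid c(\alpha,\beta)\le i\}$ satisfies $\mathrm{acc}^+(D^c_{\le i}(\beta))\subseteq D^c_{\le i}(\beta)$. *)

(* Defs.v *)
From mathcomp Require Import all_boot all_order.
From mathcomp Require Import boolp classical_sets functions cardinality.

Set Implicit Arguments.
Unset Strict Implicit.
Unset Printing Implicit Defensive.

Local Open Scope classical_set_scope.
Local Open Scope card_scope.
Local Open Scope order_scope.

(* The cardinal kappa is a well-ordered type K whose order type is an initial
   ordinal.  As with von Neumann ordinals, an ordinal <= kappa is the set of
   the smaller ordinals, that is, a downward closed subset of K; kappa is
   [set: K], an element x of K is the ordinal [below x], the order on ordinals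
   is inclusion, and the supremum of a set of ordinals is its union. *)

Section Ordinals.
Context {d : Order.disp_t} {K : orderType d}.
Implicit Types (A : set K) (x y : K).

Definition below x : set K := [set y | y < x].

Definition is_ordinal A : Prop := forall x y, A x -> y <= x -> A y.

Definition is_cardinal A : Prop :=
  is_ordinal A /\ forall x, A x -> ~ (A #= below x).

Definition osup A : set K := \bigcup_(x in A) below x.

(* sup {x + 1 | x in A}; the ordinal x + 1 is [set y | y <= x] *)
Definition ossup A : set K := \bigcup_(x in A) [set y | y <= x].

(* sup (A `&` x) = x > 0 *)
Definition acc_point A x : Prop :=
  osup (A `&` below x) = below x /\ below x !=set0.

Definition acc_plus A : set K := [set x | ossup A x /\ acc_point A x].

Definition is_min A x : Prop := A x /\ lbound A x.

End Ordinals.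

Definition regular_uncountable_cardinal d (K : orderType d) : Prop :=
  [/\ well_founded (fun x y : K => x < y),
      is_cardinal [set: K],
      ~ countable [set: K] &
      forall A : set K, osup A = [set: K] -> A #= [set: K]].

Section CSequences.
Context {d : Order.disp_t} {K : orderType d}.
Implicit Types (C : K -> set K) (chi : set K).

Definition closed_in (A : set K) (b : K) : Prop :=
  A `<=` below b /\ forall a, a < b -> acc_point A a -> A a.

Definition C_sequence C : Prop :=
  forall b, closed_in (C b) b /\ osup (C b) = osup (below b).

Definition C_covering C chi : Prop :=
  exists (Delta : set K) (b : K -> set K),
    [/\ Delta #= [set: K],
        forall a, b a #= chi &
        forall a, Delta `&` below a `<=` \bigcup_(x in b a) C x].

Definition is_C_number C chi : Prop :=
  [/\ is_cardinal chi, C_covering C chi &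
      forall chi', is_cardinal chi' -> C_covering C chi' -> chi `<=` chi'].

(* an ordinal lies outside omega iff it is infinite *)
Definition spec : set (set K) :=
  [set chi | (exists2 C, C_sequence C & is_C_number C chi) /\
             ~ finite_set chi].

End CSequences.

Section Colorings.
Context {d : Order.disp_t} {K : orderType d}.
(* a coloring c of unordered pairs is given by its values c x y for x < y;
   the other values of c are irrelevant *)
Implicit Types (c : K -> K -> K) (mu theta chi a b : set K).

Definition is_coloring theta c : Prop := forall x y, x < y -> theta (c x y).

Definition set_lt a b : Prop := forall x y, a x -> b y -> x < y.

(* c[a x b], for a < b *)
Definition rect_image c a b : set K := [set c x y | x in a & y in b].

Definition U_witness mu theta chi c : Prop :=
  is_coloring theta c /\
  forall chi', is_cardinal chi' -> chi' `<` chi ->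
  forall F : set (set K),
    (forall a, F a -> a #= chi') -> F #= [set: K] -> trivIset F id ->
  forall i, theta i ->
  exists G : set (set K), [/\ G `<=` F, G #= mu &
    forall a b, G a -> G b -> set_lt a b ->
      exists2 m, is_min (rect_image c a b) m & i < m].

(* D^c_{<= i}(y); inclusion is c x y <= i in the order of ordinals *)
Definition D_le c (i : set K) (y : K) : set K :=
  [set x | x < y /\ below (c x y) `<=` i].

(* i ranges over the ordinals i <= theta, including theta itself *)
Definition closed_coloring theta c : Prop :=
  forall (y : K) (i : set K), is_ordinal i -> i `<=` theta ->
    acc_plus (D_le c i y) `<=` D_le c i y.

End Colorings.

(* Main.v *)
Require Import Defs.
From mathcomp Require Import all_boot all_order.
From mathcomp Require Import boolp classical_sets functions cardinality.

(* Let Delta and b be as in the definition of chi(C), let e_s map chi onto b(s),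
   n(a) = min (Delta \ a), and let E_i(y) be the union of the C-sets indexed by
   e_s(j), j <= i, where s = n(y) + 1.  The coloring c(a, y) is the least i such
   that a is an accumulation point of E_i(y) or n(a) is in E_i(y); this makes c
   closed.

   Suppose c fails to witness U for a family F and a bound i.  Then there is
   g : kappa -> kappa such that every b in F above g(x) contains some y with
   c(a, y) <= i for some a in (x, g(x)).  Hence for each delta closed under g
   and each b in F above delta, the union of the E_i(y), y in b, is unbounded in
   delta.  This is a union of fewer than chi C-sets, so if delta has large
   cofinality then one of them, C_t, is already unbounded in delta, and delta
   belongs to C_t or C_{t+1}.  Thus fewer than chi C-sets cover the unboundedly
   many such delta below any ordinal, against the minimality of chi. *)

Set Implicit Arguments.
Unset Strict Implicit.
Unset Printing Implicit Defensive.

Import Order.TTheory.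

Local Open Scope classical_set_scope.
Local Open Scope card_scope.
Local Open Scope order_scope.

(** * Well-founded recursion with choice, and comparison of cardinalities *)

(** Since [Q x] reads its function only at predecessors of [x], values can be chosen by recursion,
    the partial function built so far being completed by [u0]. *)
Lemma wf_choice (T U : Type) (u0 : U) (R : T -> T -> Prop)
    (Q : T -> (T -> U) -> U -> Prop) :
  well_founded R ->
  (forall x g h u, (forall y, R y x -> g y = h y) -> Q x g u -> Q x h u) ->
  (forall x g, exists u, Q x g u) ->
  exists f : T -> U, forall x, Q x f (f x).
Proof.
move=> wfR Qext Qex.
have [G GP] := boolp.choice (fun p : T * (T -> U) => Qex p.1 p.2).
pose ext x (r : forall y, R y x -> U) y :=
  if pselect (R y x) is left h then r y h else u0.
pose F x (r : forall y, R y x -> U) := G (x, ext x r).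
exists (Fix wfR (fun=> U) F) => x; rewrite Fix_eq; last first.
  move=> {}x f g fg; congr (G (x, _)); apply/funext => y.
  by rewrite /ext; case: pselect.
apply: (Qext _ _ _ _ _ (GP (x, _))) => y Ryx /=.
by rewrite /ext; case: pselect.
Qed.

(* The default [u0] stands in for a [pointedType] structure on the codomain,
   which an [orderType] does not have. *)
Lemma card_le_fun (T U : Type) (u0 : U) (A : set T) (B : set U) :
  A #<= B -> exists f : T -> U,
    (forall x, A x -> B (f x)) /\ {in A &, injective f}.
Proof.
move=> /card_leP[f].
pose g x :=
  if pselect (A x) is left h then val (f (SigSub (mem_set h))) else u0.
exists g; split=> [x Ax|x y /set_mem Ax /set_mem Ay].
  by rewrite /g; case: pselect => // h; exact: set_valP.
rewrite /g; case: pselect => // hx; case: pselect => // hy /val_inj.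
by move=> /(@inj _ _ _ f); rewrite !in_setE => /(_ I I) /(congr1 val).
Qed.

Lemma card_eq_fun (T U : Type) (u0 : U) (A : set T) (B : set U) :
  A #= B -> exists2 f : T -> U, f @` A = B & {in A &, injective f}.
Proof.
move=> /card_eqP[f].
pose g x :=
  if pselect (A x) is left h then val (f (SigSub (mem_set h))) else u0.
exists g => [|x y /set_mem Ax /set_mem Ay].
  apply/seteqP; split=> [_ [x Ax <-]|y By].
    by rewrite /g; case: pselect => // h; exact: set_valP.
  have [[x /= xA] _ fxy] := @surj _ _ _ _ f (SigSub (mem_set By)) I.
  have Ax := set_mem xA; exists x => //; rewrite /g; case: pselect => // h.
  rewrite (_ : SigSub _ = SigSub xA) ?fxy//; exact: val_inj.
rewrite /g; case: pselect => // hx; case: pselect => // hy /val_inj.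
by move=> /(@inj _ _ _ f); rewrite !in_setE => /(_ I I) /(congr1 val).
Qed.

Lemma card_le_inj (T U : Type) (f : T -> U) (A : set T) (B : set U) :
  (forall x, A x -> B (f x)) -> {in A &, injective f} -> A #<= B.
Proof.
move=> AB fi; apply: (@card_le_trans _ _ _ (f @` A)).
  by have := inj_card_eq fi; rewrite card_eq_sym => /card_eqPle[].
by apply: subset_card_le => _ [x Ax <-]; exact: AB.
Qed.

Lemma card_le_surj (T U : Type) (f : T -> U) (A : set T) (B : set U) :
  B `<=` f @` A -> B #<= A.
Proof.
by move=> /subset_card_le/card_le_trans; apply; exact: card_image_le.
Qed.

Lemma card_le_surj_fun (T U : Type) (t0 : T) (u0 : U) (A : set T) (B : set U) :
  A #<= B -> exists f : U -> T, A `<=` f @` B.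
Proof.
move=> /(card_le_fun u0)[g [AB gi]].
have /boolp.choice[f fP] :
    forall u, exists t, forall t', A t' -> g t' = u -> t = t'.
  move=> u; have [[t [At gt]]|nt] := pselect (exists t, A t /\ g t = u).
    by exists t => t' At' gt'; apply: gi; rewrite ?in_setE// gt.
  by exists t0 => t' At' gt'; case: nt; exists t'.
by exists f => t At; exists (g t); [exact: AB|exact: fP].
Qed.

Lemma card_le_sqr_set (T U : Type) (u0 : U) (A : set T) (B : set U) :
  A #<= B -> A `*` A #<= B `*` B.
Proof.
move=> /(card_le_fun u0)[f [AB fi]].
apply: (card_le_inj (f := fun p => (f p.1, f p.2))).
  by move=> [x y] [/= /AB ? /AB ?].
move=> [x y] [x' y'] /set_mem[/= Ax Ay] /set_mem[/= Ax' Ay'] [].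
by move=> /fi -> ; rewrite ?in_setE// => /fi ->; rewrite ?in_setE.
Qed.

(** * Well-orders and squares of infinite segments *)

Section WellOrder.
Context {d : Order.disp_t} {K : orderType d}.
Hypothesis wfK : well_founded (fun x y : K => x < y).

Lemma wf_least (A : set K) :
  A !=set0 -> exists2 x, A x & forall y, A y -> x <= y.
Proof.
move=> [x]; elim/(well_founded_ind wfK): x => x IH Ax.
have [[y [Ay yx]]|nA] := pselect (exists y, A y /\ y < x).
  exact: IH yx Ay.
by exists x => // y Ay; rewrite leNgt; apply/negP => yx; apply: nA; exists y.
Qed.

(* Goedel's canonical ordering of pairs *)
Let pair_lt (p q : K * K) := Order.max p.1 p.2 < Order.max q.1 q.2 \/
  Order.max p.1 p.2 = Order.max q.1 q.2 /\
  (p.1 < q.1 \/ p.1 = q.1 /\ p.2 < q.2).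

Let wf_pair_lt : well_founded pair_lt.
Proof.
suff H m x y : Order.max x y = m -> Acc pair_lt (x, y).
  by move=> [x y]; exact: H.
elim/(well_founded_ind wfK): m x y => m IHm x.
elim/(well_founded_ind wfK): x => x IHx y.
elim/(well_founded_ind wfK): y => y IHy mE.
constructor => -[x' y'] [/= lt_m|[/= eq_m lt_xy]].
  by apply: (IHm (Order.max x' y')) => //; rewrite -mE.
have m'E : Order.max x' y' = m by rewrite eq_m.
case: lt_xy => [lt_x|[xE lt_y]]; first exact: IHx lt_x _ m'E.
by move: m'E; rewrite xE; exact: IHy.
Qed.

Let pair_lt_total p q : p <> q -> pair_lt p q \/ pair_lt q p.
Proof.
rewrite /pair_lt; case: p q => x y [x' y'] /= npq.
have [||mm'] := ltgtP (Order.max x y) (Order.max x' y'); [by auto..|].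
have [xx'|xx'|xx'] := ltgtP x x'; first by left; right; split; last left.
  by right; right; split; last left.
have [yy'|yy'|yy'] := ltgtP y y'; first by left; right; split; last right.
  by right; right; split; last right.
by case: npq; rewrite xx' yy'.
Qed.

Let segE (m : K) : [set y | y <= m] = m |` below m.
Proof.
apply/seteqP; split=> y; rewrite /setU /= le_eqVlt.
  by move=> /orP[/eqP|]; [left|right].
by move=> [->|->]; rewrite ?eqxx ?orbT.
Qed.

Let seg_le_sqr (m : K) : infinite_set (below m) ->
  [set y | y <= m] #<= below m `*` below m.
Proof.
move=> minf; have [a am] := infinite_setN0 minf.
have [b [bm ba]] : exists b, below m b /\ b <> a.
  apply: contrapT => nb; apply: minf.
  apply: sub_finite_set (finite_set1 a) => y ym.
  by apply: contrapT => ya; apply: nb; exists y.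
(* A pair [(y, a)] codes [y] and every other pair codes [m]; [b] provides a pair of the second
   sort. *)
apply: (card_le_surj (f := fun p => if p.2 == a then p.1 else m)) => y /=.
rewrite le_eqVlt => /orP[/eqP ->|ym]; last by exists (y, a); rewrite //= eqxx.
by exists (a, b) => //=; case: eqP.
Qed.

(** Induction on [z]. If [z] is not initial, the claim passes up from a smaller segment of the same
    size. If it is, too few pairs precede a given one in [pair_lt] to exhaust [below z], so an
    injection can be chosen greedily. *)
Lemma card_le_sqr (z : K) : infinite_set (below z) ->
  below z `*` below z #<= below z.
Proof.
elim/(well_founded_ind wfK): z => z IH zinf.
have [[x [xz zx]]|zinit] := pselect (exists x, x < z /\ below z #<= below x).
  have xinf : infinite_set (below x) by move=> /(card_le_finite zx).
  have xz' : below x #<= below z.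
    by apply: subset_card_le => y /= /lt_trans; apply.
  apply: card_le_trans xz'; apply: card_le_trans (IH _ xz xinf).
  exact: card_le_sqr_set.
have sq m : m < z -> ~ (below z #<= [set y | y <= m] `*` [set y | y <= m]).
  move=> mz zm.
  have [mfin|minf] := pselect (finite_set (below m)).
    apply/zinf/(card_le_finite zm)/finite_setX; rewrite segE finite_setU;
    by split=> //; exact: finite_set1.
  have mm := card_le_trans (seg_le_sqr minf) (IH _ mz minf).
  apply: zinit; exists m; split=> //; apply: card_le_trans (IH _ mz minf).
  exact/(card_le_trans zm)/(card_le_sqr_set z).
have [f fP] : exists f : K * K -> K, forall p, (below z p.1 /\ below z p.2) ->
    below z (f p) /\ forall q, pair_lt q p -> f q <> f p.
  apply: (wf_choice z (Q := fun p f u => (below z p.1 /\ below z p.2) ->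
    below z u /\ forall q, pair_lt q p -> f q <> u) wf_pair_lt).
    by move=> p g h u gh H /H[uz uP]; split=> // q qp; rewrite -gh//; exact: uP.
  move=> [x y] g; apply: contrapT => nu.
  have [xz yz] : below z x /\ below z y.
    by apply: contrapT => nxy; apply: nu; exists z.
  (* All predecessors of [(x, y)] lie in the square of the segment up to the larger coordinate; if
     no value were free, [g] on that square would exhaust [below z]. *)
  apply: (sq (Order.max x y)); first by rewrite gt_max; apply/andP.
  apply: (card_le_surj (f := g)) => u uz; apply: contrapT => ug; apply: nu.
  exists u => _; split=> // -[x' y'] qp gqu; apply: ug; exists (x', y') => //.
  have : Order.max x' y' <= Order.max x y by case: qp => /= [/ltW//|[->]].
  by rewrite ge_max => /andP.
apply: (card_le_inj (f := f)) => [[x y] xy|p q /set_mem pz /set_mem qz fpq].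
  exact: (fP (x, y) xy).1.
apply: contrapT => /pair_lt_total[pq|qp].
- exact: (fP q qz).2 _ pq fpq.
- exact: (fP p pz).2 _ qp (esym fpq).
Qed.

Lemma card_le_seg (m : K) : infinite_set (below m) ->
  [set y | y <= m] #<= below m.
Proof.
by move=> minf; exact: card_le_trans (seg_le_sqr minf) (card_le_sqr minf).
Qed.

Lemma infinite_seg (m : K) :
  infinite_set [set y | y <= m] -> infinite_set (below m).
Proof.
move=> segm fm; apply: segm; rewrite segE finite_setU.
by split=> //; exact: finite_set1.
Qed.

End WellOrder.

(** * Regularity, fast sequences and points of large cofinality *)

Definition unbounded_below {d} {K : orderType d} (A : set K) (x : K) : Prop :=
  forall e, e < x -> exists a, [/\ A a, e < a & a < x].

Section Regular.
Context {d : Order.disp_t} {K : orderType d}.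
Hypothesis hK : regular_uncountable_cardinal K.

Let wfK : well_founded (fun x y : K => x < y).
Proof. by case: hK. Qed.

Lemma acc_pointE (A : set K) x :
  acc_point A x <-> unbounded_below A x /\ below x !=set0.
Proof.
split=> [[AE x0]|[Ax x0]]; split=> //.
  move=> e ex; have : below x e by [].
  by rewrite -AE => -[a [Aa ax] ea]; exists a.
apply/seteqP; split=> [e [a [_ /= ax] /= /lt_trans]|]; first exact.
by move=> e /Ax[a [Aa ea ax]]; exists a.
Qed.

Lemma setT_not_le (x : K) : ~ ([set: K] #<= below x).
Proof.
move=> Tx; have [_ [_ /(_ x I) cardK] _ _] := hK; apply: cardK.
by apply/card_eqPle; split=> //; exact: card_leT.
Qed.

Lemma infinite_card : infinite_set [set: K].
Proof. by have [_ _ unc _] := hK => /finite_set_countable. Qed.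

(** A maximum [x] would make [K] no larger than [below x], by [card_le_seg], although kappa is an
    initial ordinal. *)
Lemma no_max (x : K) : exists y, x < y.
Proof.
apply: contrapT => nx.
have xT : [set y | y <= x] = [set: K].
  apply/seteqP; split=> y // _ /=; rewrite leNgt; apply/negP => xy.
  by apply: nx; exists y.
have := infinite_card; rewrite -xT => /(infinite_seg) xinf.
by apply: (@setT_not_le x); rewrite -xT; exact: card_le_seg wfK _ _.
Qed.

Definition osucc (x : K) : K :=
  projT1 (cid2 (wf_least wfK (no_max x))).

Lemma lt_osucc (x : K) : x < osucc x.
Proof. by rewrite /osucc; case: cid2. Qed.

Lemma le_of_lt_osucc (x y : K) : y < osucc x -> y <= x.
Proof.
rewrite /osucc; case: cid2 => z /= xz zmin yz.
rewrite leNgt; apply/negP => /zmin.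
by rewrite leNgt yz.
Qed.

Lemma bounded_of_card_neq (A : set K) :
  ~ (A #= [set: K]) -> exists u : K, forall a, A a -> a < u.
Proof.
have [_ _ _ reg] := hK => AK.
have [v Av] : exists v, ~ osup A v.
  apply: contrapT => nv; apply: AK; apply: reg; apply/seteqP; split=> v // _.
  by apply: contrapT => Av; apply: nv; exists v.
exists (osucc v) => a Aa; apply: le_lt_trans (lt_osucc v).
by rewrite leNgt; apply/negP => va; apply: Av; exists a.
Qed.

Lemma bounded_of_card_le (A : set K) (x : K) :
  A #<= below x -> exists u : K, forall a, A a -> a < u.
Proof.
move=> Ax; apply: bounded_of_card_neq => AK; apply: (@setT_not_le x).
by apply: card_le_trans Ax; move: AK; rewrite card_eq_sym => /card_eqPle[].
Qed.

Lemma card_of_unbounded (A : set K) :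
  (forall x, exists2 a, A a & x < a) -> A #= [set: K].
Proof.
move=> Aub; have [_ _ _] := hK; apply.
by apply/seteqP; split=> // x _; have [a Aa xa] := Aub x; exists a.
Qed.

(** By regularity, the fewer than kappa values chosen so far and their images under [g] are bounded,
    so the recursion never stops. *)
Lemma fast_sequence (g : K -> K) (e : K) : exists f : K -> K,
  forall x, e < f x /\ forall y, y < x -> g (f y) < f x /\ f y < f x.
Proof.
apply: (wf_choice e (Q := fun x f u => e < u /\
  forall y, y < x -> g (f y) < u /\ f y < u) wfK).
  by move=> x f h u fh [eu fu]; split=> // y yx; rewrite -fh//; exact: fu.
move=> x f.
have [u fu] : exists u, forall a,
    ((fun y => Order.max (g (f y)) (f y)) @` below x) a -> a < u.
  by apply: (@bounded_of_card_le _ x); exact: card_image_le.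
exists (Order.max u (osucc e)); split=> [|y yx].
  by rewrite lt_max lt_osucc orbT.
have : Order.max (g (f y)) (f y) < u by apply: fu; exists y.
by rewrite gt_max => /andP[gu fyu]; rewrite !lt_max gu fyu.
Qed.

(** Sets of size below [chi] need not form such an ideal when [chi] is singular. The ideals used are
    the finite sets, or the sets no larger than a fixed infinite segment. *)
Record small_ideal (small : set K -> Prop) : Prop := {
  small_le : forall A B : set K, A #<= B -> small B -> small A;
  small_finite : forall A : set K, finite_set A -> small A;
  small_bigcup : forall (I : set K) (A : K -> set K), small I ->
    (forall t, I t -> small (A t)) -> small (\bigcup_(t in I) A t) }.

Section Small.
Variable small : set K -> Prop.
Hypothesis smallP : small_ideal small.

Lemma smallS (A B : set K) : A `<=` B -> small B -> small A.
Proof. by move=> /subset_card_le; exact: small_le. Qed.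

Lemma smallU (A B : set K) : small A -> small B -> small (A `|` B).
Proof.
move=> sA sB; have [x _] := infinite_setN0 infinite_card.
have xx : (osucc x == x) = false by rewrite gt_eqF// lt_osucc.
apply: (@smallS _ (\bigcup_(t in [set x; osucc x]) if t == x then A else B)).
  move=> a [Aa|Ba]; first by exists x; [left|rewrite eqxx].
  by exists (osucc x); [right|rewrite xx].
apply: (small_bigcup smallP) => [|t _]; last by case: ifP.
exact: (small_finite smallP).
Qed.

(* [delta] is the supremum of a fast sequence whose length [w] is the least
   ordinal that is not small. *)
Lemma large_cofinality (w0 : K) : ~ small (below w0) ->
  forall (g : K -> K) (e : K), exists delta, [/\ e < delta,
    forall x, x < delta -> exists2 x', x <= x' & x' < delta /\ g x' < delta &
    forall (I : set K) (A : K -> set K), small I ->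
      unbounded_below (\bigcup_(t in I) A t) delta ->
      exists2 t, I t & unbounded_below (A t) delta].
Proof.
move=> w0P g e.
have [|w wP wmin] := @wf_least _ _ wfK [set w | ~ small (below w)].
  by exists w0.
have wsmall y : y < w -> small (below y).
  by move=> yw; apply: contrapT => /wmin; rewrite leNgt yw.
(* [w] is a limit, because a small set stays small when a point is added. *)
have wlim y : y < w -> exists2 y', y < y' & y' < w.
  move=> yw; apply: contrapT => nw; apply: wP.
  apply: smallS (smallU (small_finite smallP (finite_set1 y)) (wsmall _ yw)).
  move=> x /= xw.
  by have [xy|yx|->] := ltgtP x y; [right|case: nw; exists x|left].
have [y0 y0w] : below w !=set0.
  apply: contrapT => nw; apply: wP.
  apply: smallS (small_finite smallP (finite_set1 w)) => x xw.
  by case: nw; exists x.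
have [f fP] := fast_sequence g e.
have [u0 u0P] : exists u, forall a, (f @` below w) a -> a < u.
  by apply: (@bounded_of_card_le _ w); exact: card_image_le.
have [|delta dP dmin] := @wf_least _ _ wfK [set u | forall y, y < w -> f y < u].
  by exists u0 => y yw; apply: u0P; exists y.
have cof x : x < delta -> exists2 y, y < w & x <= f y.
  move=> xd; apply: contrapT => nx; move: xd; rewrite ltNge => /negP; apply.
  apply: dmin => y yw; rewrite ltNge; apply/negP => xy.
  by apply: nx; exists y.
exists delta; split.
- exact: lt_trans (fP y0).1 (dP _ y0w).
- move=> x /cof[y yw xy]; exists (f y) => //; split; first exact: dP.
  have [y' yy' y'w] := wlim _ yw.
  exact: lt_trans ((fP y').2 _ yy').1 (dP _ y'w).
- move=> I A Ismall AU; apply: contrapT => nt.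
  (* If no [A t] is unbounded in [delta], a term [f (xi t)] bounds the part of [A t] below
     [delta]. *)
  have [xi xiP] : exists xi : K -> K, forall t, I t ->
      xi t < w /\ forall a, A t a -> a < delta -> a <= f (xi t).
    suff /boolp.choice[xi xiP] : forall t, exists x, I t -> x < w /\
        forall a, A t a -> a < delta -> a <= f x by exists xi.
    move=> t; have [It|?] := pselect (I t); last by exists w.
    have [x xd xA] : exists2 x, x < delta &
        forall a, A t a -> a < delta -> a <= x.
      apply: contrapT => nx; apply: nt; exists t => // x xd.
      apply: contrapT => na; apply: nx; exists x => // a Aa ad.
      by rewrite leNgt; apply/negP => xa; apply: na; exists a.
    have [y yw xy] := cof _ xd.
    by exists y => _; split=> // a Aa ad; exact: le_trans (xA _ Aa ad) xy.
  (* Otherwise the segments below the [xi t] would cover [below w], making it a small union of small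
     sets. *)
  have [x xw xP] : exists2 x, x < w & forall t, I t -> xi t <= x.
    apply: contrapT => nx; apply: wP.
    apply: smallS (small_bigcup smallP Ismall (A := fun t => below (xi t)) _)
      => [x xw|t It].
      apply: contrapT => nxt; apply: nx; exists x => // t It.
      by rewrite leNgt; apply/negP => xt; apply: nxt; exists t.
    exact: wsmall (xiP _ It).1.
  have [a [[t It Aa] xa ad]] := AU _ (dP _ xw).
  have := (xiP _ It).2 _ Aa ad; rewrite leNgt => /negP; apply.
  apply: le_lt_trans xa; have := xP _ It; rewrite le_eqVlt => /orP[/eqP->//|].
  by move=> /(fP x).2[_ /ltW].
Qed.

End Small.
End Regular.

(** * The closed coloring built from a C-sequence *)

Section Coloring.
Context {d : Order.disp_t} {K : orderType d}.
Hypothesis hK : regular_uncountable_cardinal K.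
Variable C : K -> set K.
Hypothesis hC : C_sequence C.

Let wfK : well_founded (fun x y : K => x < y).
Proof. by case: hK. Qed.

Local Notation osucc := (osucc hK).

(** If [x] were missing, the condition on suprema would make [C (osucc x)] accumulate at [x], and
    closedness would put [x] back. *)
Lemma mem_C_osucc (x : K) : below x !=set0 -> C (osucc x) x.
Proof.
move=> x0; apply: contrapT => nCx; apply: (nCx).
have [[Csub Cclosed] Csup] := hC (osucc x).
apply: Cclosed; first exact: lt_osucc.
apply/acc_pointE; split=> // e ex.
have : osup (below (osucc x)) e by exists x => //; exact: lt_osucc.
rewrite -Csup => -[a Ca ea]; exists a; split=> //.
have := le_of_lt_osucc (Csub _ Ca); rewrite le_eqVlt => /orP[/eqP ax|//].
by move: Ca; rewrite ax => /nCx.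
Qed.

(** The successor handles [x = y], where closedness in [y] says nothing about [y] itself. *)
Lemma mem_C_of_unbounded_below (x y : K) : below x !=set0 ->
  unbounded_below (C y) x -> C y x \/ C (osucc y) x.
Proof.
move=> x0 Cx; have [[Csub Cclosed] _] := hC y.
have [xy|yx|<-] := ltgtP x y.
- by left; apply: Cclosed => //; apply/acc_pointE.
- by have [a [/Csub ay /lt_trans/(_ ay)]] := Cx _ yx; rewrite ltxx.
- by right; exact: mem_C_osucc.
Qed.

(** The form in which minimality of [chi] is used: the sets [b x] may vary in size, and [Delta] need
    only be unbounded, which by regularity gives it size kappa. *)
Definition no_small_cover (small : set K -> Prop) : Prop :=
  forall (Delta : set K) (b : K -> set K),
  (forall x, exists2 a, Delta a & x < a) -> (forall x, small (b x)) ->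
  ~ forall x, Delta `&` below x `<=` \bigcup_(t in b x) C t.

Lemma small_not_unbounded_below (small : set K -> Prop) (g : K -> K)
    (b : K -> set K) :
  small_ideal small -> no_small_cover small -> (forall x, small (b x)) ->
  ~ forall delta,
    (forall x, x < delta -> exists2 x', x <= x' & x' < delta /\ g x' < delta) ->
    forall x, delta < x -> unbounded_below (\bigcup_(t in b x) C t) delta.
Proof.
move=> smallP noc bsmall bub.
(* If every segment were small, the successors of the points below [x] would index a small cover of
   the positive points below [x]. *)
have [w0 w0P] : exists w, ~ small (below w).
  apply: contrapT => nw.
  apply: (noc [set y | below y !=set0] (fun x => osucc @` below x))
    => [x|x|x y [y0 yx]].
  - by exists (osucc x); [exists x|]; rewrite /=; exact: lt_osucc.
  - apply: (small_le smallP (card_image_le _ _)); apply: contrapT => ?.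
    by apply: nw; exists x.
  - by exists (osucc y); [exists y|exact: mem_C_osucc].
(* Closure is asked only cofinally: [g] need not be monotone, and a fast sequence controls it only
   at its own terms. *)
pose closed_under delta :=
  forall x, x < delta -> exists2 x', x <= x' & x' < delta /\ g x' < delta.
pose cofinal delta := forall (I : set K) (A : K -> set K), small I ->
  unbounded_below (\bigcup_(t in I) A t) delta ->
  exists2 t, I t & unbounded_below (A t) delta.
apply: (noc [set y | [/\ below y !=set0, closed_under y & cofinal y]]
  (fun x => b x `|` osucc @` b x)) => [x|x|x y [[y0 yg ycof] yx]].
- have [y [xy yg ycof]] := large_cofinality hK smallP w0P g x.
  by exists y => //; split=> //; exists x.
- apply: (smallU hK smallP) => //.
  exact: (small_le smallP (card_image_le _ _)).
- have [t bt Cty] := ycof _ _ (bsmall x) (bub _ yg _ yx).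
  have [?|?] := mem_C_of_unbounded_below y0 Cty; first by exists t; [left|].
  by exists (osucc t); [right; exists t|].
Qed.

(** Minimality of [chi] enters only through the ideals. They may depend on [x], because a given
    family and bound involve a single segment of [chi]. *)
Lemma closed_U_witness (chi : set K) : is_ordinal chi -> C_covering C chi ->
  (forall x, chi x -> exists small : set K -> Prop,
    [/\ small_ideal small, no_small_cover small & small (below x)]) ->
  exists c : K -> K -> K, U_witness [set: K] chi chi c /\ closed_coloring chi c.
Proof.
move=> chi_ord chi_cover chi_small.
have [Delta [B [DeltaK Bchi Bcov]]] := chi_cover.
have [k0 _] := infinite_setN0 (infinite_card hK).
have Delta_unb x : exists2 a, Delta a & x < a.
  apply: contrapT => nx; apply: (@setT_not_le _ _ hK (osucc x)).
  apply: (@card_le_trans _ _ _ Delta).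
    by move: DeltaK; rewrite card_eq_sym => /card_eqPle[].
  apply: subset_card_le => a Da; rewrite /below /=.
  apply: le_lt_trans (lt_osucc hK x).
  by rewrite leNgt; apply/negP => xa; apply: nx; exists a.
have /boolp.choice[e eP] : forall y, exists e : K -> K, e @` chi = B y.
  move=> y; have := Bchi y.
  by rewrite card_eq_sym => /(card_eq_fun k0)[e]; exists e.
have /boolp.choice[n nP] : forall a, exists m,
    [/\ Delta m, a <= m & forall m', Delta m' -> a <= m' -> m <= m'].
  move=> a; have [|m [Dm am] mmin] :=
    @wf_least _ _ wfK [set m | Delta m /\ a <= m].
    by have [m Dm /ltW am] := Delta_unb a; exists m.
  by exists m; split=> // m' Dm' am'; apply: mmin.
have n_le a a' : a <= a' -> n a <= n a'.
  move=> aa'; have [Dn' an' _] := nP a'; have [_ _] := nP a.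
  by apply=> //; exact: le_trans an'.
have n_ge a : a <= n a by case: (nP a).
(* The index [osucc (n y)] makes [Bcov] apply to [n a] for all [a < y], since [n a <= n y]; [n a]
   itself may exceed [y]. *)
pose E i y := \bigcup_(j in [set j | chi j /\ j <= i]) C (e (osucc (n y)) j).
pose P i a y := acc_point (E i y) a \/ E i y (n a).
have E_le i i' y : i <= i' -> E i y `<=` E i' y.
  move=> ii' a [j [cj ji] ?]; exists j => //.
  by split=> //; exact: le_trans ii'.
have P_le i i' a y : i <= i' -> P i a y -> P i' a y.
  move=> /E_le Eii' [/acc_pointE[Ea a0]|/Eii'?]; last by right.
  left; apply/acc_pointE => //; split=> // x /Ea[t [/Eii' ? ? ?]].
  by exists t.
(* If some [x < a] has [n x] in [E i y] and [a <= n x], then [n x = n a]. Otherwise each [x < a]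
   with [P i x y] yields points of [E i y] close to [x] and below [a], so [E i y] accumulates at
   [a]. *)
have P_closed i y a : unbounded_below [set x | P i x y] a -> below a !=set0 ->
    P i a y.
  move=> Pa a0.
  have [[x [Ex xa nx]]|nEx] :=
      pselect (exists x, [/\ E i y (n x), x < a & a <= n x]).
    right; suff <- : n x = n a by [].
    apply: le_anti; rewrite (n_le _ _ (ltW xa)) /=.
    by have [_ _] := nP a; apply => //; case: (nP x).
  left; apply/acc_pointE => //; split=> // t /Pa[x [[Ax|Ex] tx xa]].
    have [Ex _] := (acc_pointE _ _).1 Ax; have [r [Er tr rx]] := Ex _ tx.
    by exists r; split=> //; exact: lt_trans xa.
  exists (n x); split=> //; first exact: lt_le_trans (n_ge x).
  by rewrite ltNge; apply/negP => anx; apply: nEx; exists x.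
have /boolp.choice[c2 c2P] : forall p : K * K, exists i, p.1 < p.2 ->
    [/\ chi i, P i p.1 p.2 & forall i', chi i' -> P i' p.1 p.2 -> i <= i'].
  move=> [a y] /=; have [ay|?] := boolP (a < y); last by exists a.
  have [|i [ci Pi] imin] := @wf_least _ _ wfK [set i | chi i /\ P i a y].
    have [Dn _ _] := nP a.
    have [|t] := Bcov (osucc (n y)) (n a).
      split=> //; rewrite /below /=; apply: le_lt_trans (lt_osucc hK (n y)).
      by apply: n_le; exact: ltW.
    rewrite -eP => -[j cj <-] Ca; exists j; split=> //.
    by right; exists j => //=.
  by exists i => _; split=> // i' ci' Pi'; apply: imin.
pose c a y := c2 (a, y).
have cP a y : a < y -> [/\ chi (c a y), P (c a y) a y &
    forall i', chi i' -> P i' a y -> c a y <= i'].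
  by move=> ay; have := c2P (a, y) ay.
exists c; split; last first.
  move=> y i iord ichi z [[x [xy _] /= zx] /acc_pointE[Dz z0]].
  have zy : z < y by exact: le_lt_trans xy.
  (* If [t < c z y] lay outside [i], every [q] in the set would satisfy [c q y <= t], hence
     [P t q y]; then [P_closed] gives [P t z y], against the minimality of [c z y]. *)
  split=> // t /= tc; apply: contrapT => nit.
  have [cz _ zmin] := cP _ _ zy.
  have ct : chi t by apply: chi_ord cz (ltW tc).
  suff : P t z y by move=> /(zmin _ ct); rewrite leNgt tc.
  apply: P_closed => // r /Dz[q [[qy cq] rq qz]]; exists q; split=> //=.
  have [_ Pq _] := cP _ _ qy; apply: P_le Pq; rewrite leNgt.
  by apply/negP => /cq.
split=> [x y /cP[]//|chi' [chi'ord _] [chi'sub chi'neq] F Fchi' FK Ftriv i ci].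
have [z cz chi'z] : exists2 z, chi z & chi' `<=` below z.
  have [z [cz nz]] : exists z, chi z /\ ~ chi' z.
    apply: contrapT => nz; apply: chi'neq => z cz; apply: contrapT => ncz.
    by apply: nz; exists z.
  exists z => // x cx; rewrite /below /mkset ltNge; apply/negP => zx.
  by apply: nz; exact: chi'ord cx zx.
have F_le a : F a -> a #<= below z.
  move=> /Fchi'/card_eqPle[ac _]; apply: card_le_trans ac _.
  exact: subset_card_le.
(* Otherwise choosing a point below [y] in each of the disjoint members would inject [F] into
   [below y]. *)
have F_above y : exists2 a, F a & forall x, a x -> y <= x.
  apply: contrapT => na; apply: (@setT_not_le _ _ hK y).
  apply: (@card_le_trans _ _ _ F).
    by move: FK; rewrite card_eq_sym => /card_eqPle[].
  have /boolp.choice[h hP] : forall a, exists x, F a -> a x /\ x < y.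
    move=> a; have [Fa|?] := pselect (F a); last by exists y.
    apply: contrapT => nx; apply: na; exists a => // x ax.
    by rewrite leNgt; apply/negP => xy; apply: nx; exists x.
  apply: (card_le_inj (f := h)) => [a /hP[]//|a b /set_mem Fa /set_mem Fb hab].
  apply: Ftriv => //; exists (h a); split; first exact: (hP _ Fa).1.
  by rewrite hab; exact: (hP _ Fb).1.
(* All members have the same size, so one empty member would leave [F] with a single element. *)
have F_nonempty a : F a -> a !=set0.
  move=> Fa; apply/set0P/eqP => a0; apply: (infinite_card hK).
  have /card_eqPle[_ KF] := FK; apply: card_le_finite KF _.
  apply: sub_finite_set (finite_set1 set0) => b Fb /=.
  have := card_eq_trans (Fchi' _ Fb) (card_esym (Fchi' _ Fa)).
  by rewrite a0 card_eq0 => /eqP.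
have [x0 x0P] : exists x0, forall y, exists2 a, F a &
    (forall x, a x -> y <= x) /\
    (forall x t, x0 < x -> x < y -> a t -> i < c x t).
  apply: contrapT => nx0.
  have /boolp.choice[g gP] : forall x0, exists y, forall a, F a ->
      (forall x, a x -> y <= x) ->
      exists x t, [/\ x0 < x, x < y, a t & c x t <= i].
    move=> x0; apply: contrapT => ny; apply: nx0; exists x0 => y.
    apply: contrapT => na; apply: ny; exists y => a Fa ya.
    apply: contrapT => nxt; apply: na; exists a => //.
    split=> // x t x0x xy at_; rewrite ltNge; apply/negP => ci'.
    by apply: nxt; exists x, t.
  have /boolp.choice[A AP] : forall y, exists a, F a /\ forall x, a x -> y <= x.
    by move=> y; have [a Fa ya] := F_above y; exists a.
  (* A single ideal must contain both [below z], which bounds the members of [F], and [below i],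
     which bounds the number of C-sets forming each [E i t]. *)
  have [small [smallP noc zi_small]] : exists small : set K -> Prop,
      [/\ small_ideal small, no_small_cover small &
          small (below (Order.max z i))].
    by apply: chi_small; rewrite /Order.max; case: ifP.
  have small_z : small (below z).
    apply: (smallS smallP _ zi_small) => r /= rz.
    by rewrite /below /mkset lt_max rz.
  have small_i : small (below i).
    apply: (smallS smallP _ zi_small) => r /= ri.
    by rewrite /below /mkset lt_max ri orbT.
  (* Composing with [n] keeps [n a] below [delta] when [a < g x']: in the second clause of [P] it is
     [n a] that lies in [E]. *)
  apply: (@small_not_unbounded_below small (n \o g) (fun y => \bigcup_(t in A y)
    (e (osucc (n t)) @` [set j | chi j /\ j <= i])))
    => // [y|delta gd y dy x xd].
    apply: (small_bigcup smallP) => [|t _].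
      exact: (small_le smallP (F_le _ (AP y).1)).
    apply: (small_le smallP (card_image_le _ _)).
    have small1 := small_finite smallP (finite_set1 i).
    apply: (smallS smallP _ (smallU hK smallP small1 small_i)) => j [_].
    by rewrite le_eqVlt => /orP[/eqP|]; [left|right].
  have [x' xx' [x'd gx'd]] := gd _ xd.
  have [|a [t [x'a ag At cat]]] := gP x' _ (AP y).1.
    move=> r /(AP y).2; apply: le_trans; apply/ltW/(le_lt_trans (n_ge _)).
    exact: lt_trans dy.
  have ad : a < delta by apply: lt_trans ag _; exact: le_lt_trans (n_ge _) gx'd.
  have aty : a < t by exact: lt_le_trans (lt_trans ad dy) ((AP y).2 _ At).
  have [_ /(P_le _ _ _ _ cat) Pa _] := cP _ _ aty.
  have xa := le_lt_trans xx' x'a.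
  have EC : E i t `<=` \bigcup_(t0 in \bigcup_(t in A y)
      (e (osucc (n t)) @` [set j | chi j /\ j <= i])) C t0.
    move=> r [j ? ?]; exists (e (osucc (n t)) j) => //.
    by exists t => //; exists j.
  case: Pa => [/acc_pointE[/(_ _ xa)[r [/EC ? ? ra]] _]|/EC ?].
    by exists r; split=> //; exact: lt_trans ad.
  exists (n a); split=> //; first exact: lt_le_trans (n_ge a).
  by apply: le_lt_trans gx'd; apply: n_le; exact: ltW.
have /boolp.choice[A AP] : forall y, exists a, [/\ F a,
    forall x, a x -> y <= x & forall x t, x0 < x -> x < y -> a t -> i < c x t].
  by move=> y; have [a Fa [? ?]] := x0P y; exists a.
have /boolp.choice[top topP] : forall y, exists u, forall x, A y x -> x < u.
  move=> y; have [Fy _ _] := AP y; exact: (bounded_of_card_le hK (F_le _ Fy)).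
(* Each step jumps past the previous set, so for [x < y] the set [A (f x)] lies inside the interval
   from [x0] to [f y], where the colors against [A (f y)] exceed [i]. *)
have [f fP] := fast_sequence hK top x0.
have Alt x y : x < y -> set_lt (A (f x)) (A (f y)).
  move=> xy r t /topP rtop Afy; have [_ /(_ _ Afy) fyt _] := AP (f y).
  by apply: lt_trans rtop _; apply: lt_le_trans fyt; exact: ((fP y).2 _ xy).1.
(* As the sets are nonempty, [set_lt] determines the order of the indices; this also makes the
   enumeration injective. *)
have not_lt x y : y <= x -> ~ set_lt (A (f x)) (A (f y)).
  have [/F_nonempty[r Ar] _ _] := AP (f x).
  have [/F_nonempty[t At] _ _] := AP (f y).
  rewrite le_eqVlt => /orP[/eqP yx|/Alt yx] xy.
    by move: xy; rewrite yx => /(_ _ _ Ar Ar); rewrite ltxx.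
  by have := lt_trans (xy _ _ Ar At) (yx _ _ At Ar); rewrite ltxx.
exists (range (A \o f)); split=> [_ [x _ <-]|| _ _ [x _ <-] [y _ <-] lt_xy].
- by case: (AP (f x)).
- apply: inj_card_eq => x y _ _ /= Axy.
  apply: le_anti; rewrite !leNgt; apply/andP; split; apply/negP => /Alt;
  by rewrite Axy; exact: not_lt.
- have xy : x < y by rewrite ltNge; apply/negP => /not_lt.
  have [/F_nonempty[r Ar] fx_le _] := AP (f x).
  have [/F_nonempty[t At] _ c_gt] := AP (f y).
  have [|m [r' Ar' [t' At' <-]] mmin] :=
    @wf_least _ _ wfK (rect_image c (A (f x)) (A (f y))).
    by exists (c r t), r => //; exists t.
  exists (c r' t'); first by split=> //; exists r' => //; exists t'.
  apply: c_gt => //; first exact: lt_le_trans (fP x).1 (fx_le _ Ar').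
  by apply: lt_trans (topP _ _ Ar') _; exact: ((fP y).2 _ xy).1.
Qed.

End Coloring.

(** * Ideals obtained from the minimality of [chi] *)

Section SmallIdeals.
Context {d : Order.disp_t} {K : orderType d}.
Hypothesis hK : regular_uncountable_cardinal K.

Let wfK : well_founded (fun x y : K => x < y).
Proof. by case: hK. Qed.

Lemma small_ideal_finite : small_ideal (fun A : set K => finite_set A).
Proof.
split=> // [A B|I A If Af]; first exact: card_le_finite.
exact: bigcup_finite.
Qed.

(** For unions, choose a surjection for the index set and one for each member: pairs from [below z]
    then cover the union, and [card_le_sqr] applies. *)
Lemma small_ideal_card_le (z : K) : infinite_set (below z) ->
  small_ideal (fun A : set K => A #<= below z).
Proof.
move=> zinf; split=> [A B|A Afin|I A Iz Az]; first exact: card_le_trans.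
  apply: card_le_trans (finite_set_countable Afin) _; exact/infiniteP.
have [h hI] := card_le_surj_fun z z Iz.
have /boolp.choice[f fP] :
    forall t, exists f : K -> K, I t -> A t `<=` f @` below z.
  move=> t; have [It|?] := pselect (I t); last by exists id.
  by have [f fA] := card_le_surj_fun z z (Az _ It); exists f.
apply: card_le_trans (card_le_sqr wfK zinf).
apply: (card_le_surj (f := fun p => f (h p.1) p.2)) => a [t It].
have [p pz pt] := hI _ It; move=> /(fP _ It)[q qz <-].
by exists (p, q) => //=; rewrite pt.
Qed.

Lemma exists_below_card (n : nat) : exists x : K, below x #= `I_n.
Proof.
have [k0 _] := infinite_setN0 (infinite_card hK).
elim: n => [|n [x xn]].
  have [|m _ mmin] := @wf_least _ _ wfK [set: K]; first by exists k0.
  exists m; rewrite II0 card_eq0; apply/eqP/seteqP; split=> y // ym.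
  by have := mmin y I; rewrite leNgt => /negP; apply.
exists (osucc hK x); apply/eq_cardSP; exists x; first exact: lt_osucc.
rewrite (_ : (_ `\` _)%classic = below x)//; apply/seteqP; split=> y.
  by move=> [/le_of_lt_osucc]; rewrite le_eqVlt => /orP[/eqP yx []|].
move=> yx; split; first exact: lt_trans yx (lt_osucc hK x).
by move=> /= yE; move: yx; rewrite yE /below /mkset ltxx.
Qed.

Variables (C : K -> set K) (chi : set K).
Hypothesis Cchi : is_C_number C chi.

Lemma C_number_card_le (x : K) (Delta : set K) (b : K -> set K) :
  (forall y, exists2 a, Delta a & y < a) -> (forall y, b y #= below x) ->
  (forall y, Delta `&` below y `<=` \bigcup_(t in b y) C t) ->
  chi #<= below x.
Proof.
move=> Dub bx bcov; have [_ _ chi_min] := Cchi.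
(* Minimality of [chi] speaks only of initial ordinals, so [x] is replaced by the least [x'] of its
   size. *)
have [|x' x'x x'min] := @wf_least _ _ wfK [set x' | below x' #= below x].
  by exists x; exact: card_eqxx.
have : chi `<=` below x'.
  apply: chi_min; first split=> [y z yx' zy|y yx' x'y].
  - exact: le_lt_trans zy yx'.
  - have := x'min y (card_eq_trans (card_esym x'y) x'x).
    by rewrite leNgt => /negP; apply.
  - exists Delta, b; split=> // [|y]; first exact: card_of_unbounded hK _ Dub.
    exact: card_eq_trans (bx y) (card_esym x'x).
move=> /subset_card_le/card_le_trans; apply.
by have /card_eqPle[] := x'x.
Qed.

Hypothesis chi_inf : infinite_set chi.

(* Covers by finite sets need not have bounded size; by regularity one size
   occurs at unboundedly many ordinals, which suffices. *)
Lemma no_small_cover_finite : no_small_cover C (fun A : set K => finite_set A).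
Proof.
move=> Delta b Dub bfin bcov.
have /boolp.choice[N NP] : forall x, exists n, b x #= `I_n by [].
have [n nP] : exists n, forall y, exists2 x, y <= x & N x = n.
  apply: contrapT => nn.
  (* If each size [n] stopped occurring at some [u n], these countably many bounds would have a
     common bound [v], and [N v] would be impossible. *)
  have /boolp.choice[u uP] : forall n, exists y, forall x, y <= x -> N x <> n.
    move=> n; apply: contrapT => ny; apply: nn; exists n => y.
    apply: contrapT => nx; apply: ny; exists y => x yx Nx.
    by apply: nx; exists x.
  have [v vP] : exists v : K, forall a, range u a -> a < v.
    apply: (bounded_of_card_neq hK) => uK; have [_ _ + _] := hK; apply.
    have /card_eqPle[_ Ku] := uK.
    by apply: card_le_trans Ku _; exact: card_image_le.
  by apply: (uP (N v) v) => //; apply/ltW/vP; exists (N v).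
(* A cover for a later ordinal also serves at [y], so [b (x' y)] replaces [b y] and has constant
   size. *)
have /boolp.choice[x' x'P] : forall y, exists x, y <= x /\ N x = n.
  by move=> y; have [x] := nP y; exists x.
have [w wn] := exists_below_card n.
apply: chi_inf; apply: (@card_le_finite _ _ _ (below w)); last by exists n.
apply: (C_number_card_le (b := b \o x') Dub) => y /=.
  by apply: card_eq_trans (NP _) _; rewrite (x'P y).2; exact: card_esym.
by move=> a [Da ay]; apply: bcov; split=> //; exact: lt_le_trans ay (x'P y).1.
Qed.

Lemma no_small_cover_card_le (z : K) : chi z -> infinite_set (below z) ->
  no_small_cover C (fun A : set K => A #<= below z).
Proof.
move=> cz zinf Delta b Dub bz bcov.
have [[chi_ord chi_card] _ _] := Cchi; apply: (chi_card z cz).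
apply/card_eqPle; split; last first.
  by apply: subset_card_le => y yz; exact: chi_ord cz (ltW yz).
(* Padding with [below z] gives all covers the same size. *)
apply: (C_number_card_le (b := fun y => b y `|` below z) Dub) => y.
  apply/card_eqPle; split; last by apply: subset_card_le => t; right.
  exact: (smallU hK (small_ideal_card_le zinf) (bz y) (card_lexx _)).
by move=> a /bcov[t bt Ct]; exists t => //; left.
Qed.

(** If some [z] in [chi] is infinite, the segment below the larger of [x] and [z] is infinite and
    contains [below x]. Otherwise [chi] is omega, and finite sets serve. *)
Lemma exists_small_ideal (x : K) : chi x -> exists small : set K -> Prop,
  [/\ small_ideal small, no_small_cover C small & small (below x)].
Proof.
move=> cx.
have [[z [cz zinf]]|nz] := pselect (exists z, chi z /\ infinite_set (below z)).
  have zm : below z `<=` below (Order.max x z).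
    by move=> y yz; rewrite /below /mkset lt_max yz orbT.
  have cm : chi (Order.max x z) by rewrite /Order.max; case: ifP.
  have minf := sub_infinite_set zm zinf.
  exists (fun A => A #<= below (Order.max x z)); split.
  - exact: small_ideal_card_le.
  - exact: no_small_cover_card_le.
  - by apply: subset_card_le => y yx; rewrite /below /mkset lt_max yx.
exists (fun A => finite_set A); split.
- exact: small_ideal_finite.
- exact: no_small_cover_finite.
- by apply: contrapT => xinf; apply: nz; exists x.
Qed.

End SmallIdeals.

Theorem theorem5p9 (d : Order.disp_t) (K : orderType d)
  (hK : regular_uncountable_cardinal K) (chi : set K) (hchi : spec chi) :
  exists c : K -> K -> K,
    U_witness [set: K] chi chi c /\ closed_coloring chi c.
Proof.
have [[C hC Cchi] chi_inf] := hchi; have [[chi_ord _] chi_cov _] := Cchi.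
apply: (closed_U_witness hK hC chi_ord chi_cov) => x cx.
exact: (exists_small_ideal hK Cchi chi_inf cx).
Qed.
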